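(* Let $n$ be a positive integer and let $C_n=\frac{1}{n+1}\binom{2n}{n}$ be the $n$-th Catalan number. Then $$C_n=\frac{2^{2n}}{\sqrt{\pi}}\,\exp\left[\int_0^{\infty}\left\{\frac{(1+t)^{3/2}-1}{(1+t)^{n+2}\log(1+t)}-\frac{3}{2}e^{-t}\right\}\frac{\mathrm{d}t}{t}\right].$$
   Context: $\binom{2n}{n}$ is the usual binomial coefficient and $\log$ is the natural logarithm. The integral is over the real variable $t\in(0,\infty)$. *)

(* Defs.v *)
From Stdlib Require Import Reals.
From Coquelicot Require Import Coquelicot.
Open Scope R_scope.

(* [Binomial.C] is qualified because Coquelicot's [C] is the type of complex
   numbers. *)
Definition catalan (n : nat) : R :=
  1 / (INR n + 1) * Binomial.C (2 * n) n.

Definition catalan_integrand (n : nat) (t : R) : R :=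
  ((Rpower (1 + t) (3 / 2) - 1) / ((1 + t) ^ (n + 2) * ln (1 + t))
     - 3 / 2 * exp (- t)) / t.

(* Main.v *)
Require Import Defs.
From Stdlib Require Import Reals Lra Lia.
From Coquelicot Require Import Coquelicot.
Open Scope R_scope.

(** Write [A n = C_n * sqrt PI / 4 ^ n], let [g n] be the integrand and [I n] its
    integral over (0, oo). The claim is [I n = ln (A n)]. Classically
    [A n = Gamma (n + 1/2) / Gamma (n + 2)], and the formula is a difference of two
    integral representations of the logarithm of Gamma. The proof avoids Gamma: both
    sides satisfy the same first-order recurrence in [n] and have the same behaviour as
    [n] tends to infinity.

    Recurrence. With [u = ln (1 + t)],
    [g n t - g (n + 1) t = (exp (- (n + 1/2) u) - exp (- (n + 2) u)) / ((1 + t) u)],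
    which is Frullani's integrand after the substitution [u = ln (1 + t)]. Hence
    [I n - I (n + 1) = ln (n + 2) - ln (n + 1/2)], which is also
    [ln (A n) - ln (A (n + 1))] ([is_RInt_gen_catalan_integrand_S]). So
    [I n = ln (A n) + c] with [c] independent of [n], as soon as one of the integrals
    converges.

    Asymptotics of the integral. Replacing [exp (- t)] by [exp (- (n + 2) t)] in [g n]
    costs, by Frullani's formula, [3/2 * ln (n + 2)], and leaves a nonnegative integrand
    with an explicit bound of integral O(1/n) ([remainder_bounds]). This yields the
    convergence and [I n + 3/2 * ln (n + 2) = O(1/n)]
    ([is_RInt_gen_catalan_integrand_bounds]).

    Asymptotics of the Catalan numbers. Wallis' integrals of [sin ^ n] over [0, PI/2]
    give two-sided bounds on [PI * (binomial (2 n) n / 4 ^ n) ^ 2], hence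
    [ln (A n) + 3/2 * ln (n + 2) = O(1/n)] ([ln_normalized_catalan_asymptotic]).
    Therefore [c = 0]. *)

(** * Improper integrals over (0, oo) *)

Lemma eventually_pos_interval :
  filter_prod (at_right 0) (Rbar_locally p_infty)
    (fun ab : R * R => 0 < fst ab /\ fst ab <= snd ab).
Proof.
apply Filter_prod with (Q := fun x => 0 < x < 1) (R := fun y => 1 < y).
- exists (mkposreal 1 Rlt_0_1); intros y Hy Hy0.
  change (Rabs (y - 0) < 1) in Hy; apply Rabs_def2 in Hy; simpl; lra.
- exists 1; intros; assumption.
- simpl; intros; lra.
Qed.

Lemma is_RInt_gen_pos_ext (f g : R -> R) (l : R) :
  (forall x, 0 < x -> f x = g x) ->
  is_RInt_gen f (at_right 0) (Rbar_locally p_infty) l ->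
  is_RInt_gen g (at_right 0) (Rbar_locally p_infty) l.
Proof.
intros Hfg; apply is_RInt_gen_ext.
eapply filter_imp; [|exact eventually_pos_interval].
intros [a b] [Ha Hab] x Hx; simpl in *.
rewrite Rmin_left in Hx by exact Hab; apply Hfg; lra.
Qed.

Lemma is_RInt_gen_pos_primitive (f F : R -> R) (la lb : R) :
  (forall x, 0 < x -> is_derive F x (f x)) ->
  (forall x, 0 < x -> continuous f x) ->
  filterlim F (at_right 0) (locally la) ->
  filterlim F (Rbar_locally p_infty) (locally lb) ->
  is_RInt_gen f (at_right 0) (Rbar_locally p_infty) (lb - la).
Proof.
intros HF Hf Hla Hlb.
apply is_RInt_gen_pos_ext with (f := Derive F).
{ intros x Hx; apply is_derive_unique; auto. }
apply is_RInt_gen_Derive; try assumption.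
- eapply filter_imp; [|exact eventually_pos_interval].
  intros [a b] [Ha Hab] x Hx; simpl in *.
  rewrite Rmin_left in Hx by exact Hab.
  exists (f x); apply HF; lra.
- eapply filter_imp; [|exact eventually_pos_interval].
  intros [a b] [Ha Hab] x Hx; simpl in *.
  rewrite Rmin_left in Hx by exact Hab.
  assert (Hx0 : 0 < x) by lra.
  apply continuous_ext_loc with f; [|apply Hf; exact Hx0].
  exists (mkposreal x Hx0); intros y Hy.
  change (Rabs (y - x) < x) in Hy; apply Rabs_def2 in Hy.
  symmetry; apply is_derive_unique, HF; lra.
Qed.

(** Comparison test: a continuous [f] with [0 <= f <= g], where [g] has a primitive [G]
    with limits [la] at 0 and [lb] at infinity, is integrable on (0, oo), with integral
    in [0, lb - la]. *)
Lemma is_RInt_gen_pos_dominated (f g G : R -> R) (la lb : R) :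
  (forall x, 0 < x -> continuous f x) ->
  (forall x, 0 < x -> continuous g x) ->
  (forall x, 0 < x -> 0 <= f x <= g x) ->
  (forall x, 0 < x -> is_derive G x (g x)) ->
  filterlim G (at_right 0) (locally la) ->
  filterlim G (Rbar_locally p_infty) (locally lb) ->
  exists l : R, is_RInt_gen f (at_right 0) (Rbar_locally p_infty) l /\
    0 <= l <= lb - la.
Proof.
intros Hf Hg Hfg HG Hla Hlb.
assert (If : forall a b, 0 < a -> 0 < b -> ex_RInt f a b).
{ intros a b Ha Hb; apply (ex_RInt_continuous f); intros z Hz; apply Hf.
  assert (0 < Rmin a b) by now apply Rmin_pos. lra. }
set (F := fun x => RInt f 1 x).
assert (HF : forall x, 0 < x -> is_derive F x (f x)).
{ intros x Hx; unfold F.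
  apply (is_derive_RInt f F 1 x); [|apply Hf, Hx].
  exists (mkposreal x Hx); intros y Hy.
  change (Rabs (y - x) < x) in Hy; apply Rabs_def2 in Hy.
  apply (RInt_correct f), If; lra. }
assert (HFG : forall a b, 0 < a -> a <= b -> 0 <= F b - F a <= G b - G a).
{ intros a b Ha Hab.
  assert (If' : is_RInt f a b (F b - F a)).
  { apply (is_RInt_derive F f); intros x Hx; rewrite Rmin_left in Hx by exact Hab;
      [apply HF|apply Hf]; lra. }
  assert (Ig' : is_RInt g a b (G b - G a)).
  { apply (is_RInt_derive G g); intros x Hx; rewrite Rmin_left in Hx by exact Hab;
      [apply HG|apply Hg]; lra. }
  split.
  - apply (is_RInt_le (fun _ => 0) f a b); try assumption.
    + pose proof (is_RInt_const a b (0 : R)) as H0.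
      unfold scal in H0; simpl in H0; unfold mult in H0; simpl in H0.
      now rewrite Rmult_0_r in H0.
    + intros x Hx; apply Hfg; lra.
  - apply (is_RInt_le f g a b); try assumption.
    intros x Hx; apply Hfg; lra. }
assert (HC : forall a b, 0 < a -> 0 < b -> Rabs (F b - F a) <= Rabs (G b - G a)).
{ intros a b Ha Hb; destruct (Rle_lt_dec a b) as [H|H].
  - specialize (HFG a b Ha H); rewrite !Rabs_pos_eq; lra.
  - specialize (HFG b a Hb (Rlt_le _ _ H)).
    rewrite (Rabs_minus_sym (F b)), (Rabs_minus_sym (G b)), !Rabs_pos_eq; lra. }
(* The primitive of [f] inherits the Cauchy property of the primitive of [g]. *)
assert (HL : forall (Fl : (R -> Prop) -> Prop) (l : R), ProperFilter Fl ->
  Fl (fun x => 0 < x) -> filterlim G Fl (locally l) ->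
  exists y : R, filterlim F Fl (locally y)).
{ intros Fl l HFl Hp HGl.
  apply (proj1 (filterlim_locally_cauchy (U := R_CompleteSpace) F)).
  intros eps.
  destruct (proj2 (filterlim_locally_cauchy (U := R_CompleteSpace) G)
    (ex_intro _ l HGl) eps) as [P [HP HPu]].
  exists (fun x => P x /\ 0 < x); split; [now apply filter_and|].
  intros u v [Pu u0] [Pv v0].
  apply Rle_lt_trans with (1 := HC u v u0 v0), (HPu u v Pu Pv). }
destruct (HL (at_right 0) la) as [ya Hya].
{ apply at_right_proper_filter. }
{ exists (mkposreal 1 Rlt_0_1); intros y _ Hy; exact Hy. }
{ exact Hla. }
destruct (HL (Rbar_locally p_infty) lb) as [yb Hyb].
{ apply Rbar_locally_filter. }
{ exists 0; intros; assumption. }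
{ exact Hlb. }
exists (yb - ya).
assert (HIf : is_RInt_gen f (at_right 0) (Rbar_locally p_infty) (yb - ya))
  by now apply is_RInt_gen_pos_primitive with F.
split; [exact HIf|].
assert (HIg : is_RInt_gen g (at_right 0) (Rbar_locally p_infty) (lb - la))
  by now apply is_RInt_gen_pos_primitive with G.
assert (He : filter_prod (at_right 0) (Rbar_locally p_infty)
  (fun ab : R * R => fst ab <= snd ab)).
{ eapply filter_imp; [|exact eventually_pos_interval]; simpl; tauto. }
assert (H1 : norm (yb - ya) <= lb - la).
{ apply (RInt_gen_norm f g (yb - ya) (lb - la) He); try assumption.
  eapply filter_imp; [|exact eventually_pos_interval].
  intros [a b] [Ha Hab] x Hx; simpl in *.
  change (Rabs (f x) <= g x); assert (0 <= f x <= g x) by (apply Hfg; lra).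
  rewrite Rabs_pos_eq; lra. }
(* The lower bound is the comparison of the zero function with [f]. *)
assert (H2 : norm (0 - 0) <= yb - ya).
{ apply (RInt_gen_norm (fun _ => 0) f (0 - 0) (yb - ya) He); try assumption.
  - eapply filter_imp; [|exact eventually_pos_interval].
    intros [a b] [Ha Hab] x Hx; simpl in *.
    change (Rabs 0 <= f x); rewrite Rabs_R0; apply Hfg; lra.
  - apply is_RInt_gen_pos_primitive with (fun _ => 0);
      try apply filterlim_const; intros x _;
      [apply (is_derive_const 0)|apply continuous_const]. }
change (Rabs (yb - ya) <= lb - la) in H1.
change (Rabs (0 - 0) <= yb - ya) in H2.
pose proof (Rle_abs (yb - ya)); pose proof (Rabs_pos (0 - 0)); lra.
Qed.

Lemma filterlim_at_right_0_le (f : R -> R) (l K : R) :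
  (forall x, 0 < x -> Rabs (f x - l) <= K * x) ->
  filterlim f (at_right 0) (locally l).
Proof.
intros H; apply filterlim_locally; intros eps.
assert (HK : 0 < Rabs K + 1) by (pose proof (Rabs_pos K); lra).
assert (Hd : 0 < eps / (Rabs K + 1)) by (apply Rdiv_lt_0_compat; [apply eps|lra]).
exists (mkposreal _ Hd); intros y Hy Hy0.
change (Rabs (y - 0) < eps / (Rabs K + 1)) in Hy.
rewrite Rminus_0_r, Rabs_pos_eq in Hy by lra.
change (Rabs (f y - l) < eps).
apply Rle_lt_trans with (1 := H y Hy0).
apply Rle_lt_trans with ((Rabs K + 1) * y).
- pose proof (Rle_abs K); nra.
- apply (Rmult_lt_compat_l _ _ _ HK) in Hy.
  replace ((Rabs K + 1) * (eps / (Rabs K + 1))) with (pos eps) in Hy by (field; lra).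
  exact Hy.
Qed.

Lemma filterlim_p_infty_le (f : R -> R) (l K : R) :
  (forall x, 0 < x -> Rabs (f x - l) <= K / x) ->
  filterlim f (Rbar_locally p_infty) (locally l).
Proof.
intros H; apply filterlim_locally; intros eps.
assert (HK : 0 < Rabs K + 1) by (pose proof (Rabs_pos K); lra).
assert (Hd : 0 < (Rabs K + 1) / eps) by (apply Rdiv_lt_0_compat; [lra|apply eps]).
exists ((Rabs K + 1) / eps); intros y Hy.
assert (Hy0 : 0 < y) by lra.
change (Rabs (f y - l) < eps).
apply Rle_lt_trans with (1 := H y Hy0).
apply Rmult_lt_reg_r with y; [exact Hy0|].
replace (K / y * y) with K by (field; lra).
apply (Rmult_lt_compat_l eps) in Hy; [|apply eps].
replace (eps * ((Rabs K + 1) / eps)) with (Rabs K + 1) in Hy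
  by (field; apply Rgt_not_eq, eps).
pose proof (Rle_abs K); lra.
Qed.

(** * Frullani's integral *)

(** A primitive of [exp (- v) / v] on (0, oo), normalized to vanish at 1. *)
Definition exp_div_primitive (y : R) : R := RInt (fun v => exp (- v) / v) 1 y.

Lemma continuous_exp_div (v : R) : 0 < v -> continuous (fun v => exp (- v) / v) v.
Proof.
intros Hv; apply (ex_derive_continuous (fun v => exp (- v) / v)); auto_derive; lra.
Qed.

Lemma is_derive_exp_div_primitive (y : R) :
  0 < y -> is_derive exp_div_primitive y (exp (- y) / y).
Proof.
intros Hy.
apply (is_derive_RInt (fun v => exp (- v) / v) exp_div_primitive 1 y).
2: exact (continuous_exp_div y Hy).
exists (mkposreal y Hy); intros z Hz.
change (Rabs (z - y) < y) in Hz; apply Rabs_def2 in Hz.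
apply (RInt_correct (fun v => exp (- v) / v)).
apply (ex_RInt_continuous (fun v => exp (- v) / v)); intros v Hv; apply continuous_exp_div.
assert (0 < Rmin 1 z) by (apply Rmin_pos; lra). lra.
Qed.

Lemma exp_div_primitive_bounds (y z : R) :
  0 < y -> y <= z ->
  exp (- z) * (ln z - ln y) <= exp_div_primitive z - exp_div_primitive y
    <= exp (- y) * (ln z - ln y).
Proof.
intros Hy Hyz.
assert (HE : is_RInt (fun v => exp (- v) / v) y z
  (exp_div_primitive z - exp_div_primitive y)).
{ apply (is_RInt_derive exp_div_primitive (fun v => exp (- v) / v));
    intros x Hx; rewrite Rmin_left in Hx by exact Hyz;
    [apply is_derive_exp_div_primitive|apply continuous_exp_div]; lra. }
assert (HL : forall c, is_RInt (fun v => c * / v) y z (c * (ln z - ln y))).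
{ intros c.
  replace (c * (ln z - ln y)) with (minus (c * ln z) (c * ln y))
    by (unfold minus, plus, opp; simpl; ring).
  apply (is_RInt_derive (fun v => c * ln v) (fun v => c * / v));
    intros x Hx; rewrite Rmin_left in Hx by exact Hyz.
  - auto_derive; [lra|field; lra].
  - apply (ex_derive_continuous (fun v => c * / v)); auto_derive; lra. }
split.
- apply (is_RInt_le _ _ y z _ _ Hyz (HL (exp (- z))) HE); intros x Hx.
  apply Rmult_le_compat_r; [left; apply Rinv_0_lt_compat; lra|].
  left; apply exp_increasing; lra.
- apply (is_RInt_le _ _ y z _ _ Hyz HE (HL (exp (- y)))); intros x Hx.
  apply Rmult_le_compat_r; [left; apply Rinv_0_lt_compat; lra|].
  left; apply exp_increasing; lra.
Qed.

(** A primitive of [(exp (- a x) - exp (- b x)) / x] on (0, oo). *)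
Definition frullani_primitive (a b x : R) : R :=
  exp_div_primitive (a * x) - exp_div_primitive (b * x).

Lemma is_derive_frullani_primitive (a b x : R) :
  0 < a -> 0 < b -> 0 < x ->
  is_derive (frullani_primitive a b) x ((exp (- (a * x)) - exp (- (b * x))) / x).
Proof.
intros Ha Hb Hx.
assert (HE : forall c, 0 < c ->
  is_derive (fun x => exp_div_primitive (c * x)) x (c * (exp (- (c * x)) / (c * x)))).
{ intros c Hc.
  apply (is_derive_comp exp_div_primitive (fun x => c * x)).
  - apply is_derive_exp_div_primitive; nra.
  - auto_derive; [exact I|ring]. }
replace ((exp (- (a * x)) - exp (- (b * x))) / x) with
  (minus (a * (exp (- (a * x)) / (a * x))) (b * (exp (- (b * x)) / (b * x))))
  by (unfold minus, plus, opp; simpl; field; lra).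
apply (is_derive_minus (fun x => exp_div_primitive (a * x))
  (fun x => exp_div_primitive (b * x))); auto.
Qed.

Lemma frullani_primitive_bounds (a b x : R) :
  0 < a -> a <= b -> 0 < x ->
  exp (- (b * x)) * (ln b - ln a) <= - frullani_primitive a b x
    <= exp (- (a * x)) * (ln b - ln a).
Proof.
intros Ha Hab Hx; unfold frullani_primitive.
assert (H1 : 0 < a * x) by nra.
assert (H2 : a * x <= b * x) by nra.
pose proof (exp_div_primitive_bounds _ _ H1 H2) as H.
rewrite !ln_mult in H by lra.
replace (ln b + ln x - (ln a + ln x)) with (ln b - ln a) in H by ring.
lra.
Qed.

Lemma filterlim_frullani_primitive_0 (a b : R) :
  0 < a -> a <= b ->
  filterlim (frullani_primitive a b) (at_right 0) (locally (ln a - ln b)).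
Proof.
intros Ha Hab.
apply filterlim_at_right_0_le with (b * (ln b - ln a)); intros x Hx.
pose proof (frullani_primitive_bounds a b x Ha Hab Hx) as H.
assert (HL : 0 <= ln b - ln a) by (pose proof (ln_le a b Ha Hab); lra).
assert (He1 : 1 - b * x <= exp (- (b * x))) by (pose proof (exp_ineq1_le (- (b * x))); lra).
assert (He2 : exp (- (a * x)) <= 1) by (rewrite <- exp_0; left; apply exp_increasing; nra).
apply Rabs_le; nra.
Qed.

Lemma filterlim_frullani_primitive_p_infty (a b : R) :
  0 < a -> a <= b ->
  filterlim (frullani_primitive a b) (Rbar_locally p_infty) (locally 0).
Proof.
intros Ha Hab.
apply filterlim_p_infty_le with ((ln b - ln a) / a); intros x Hx.
pose proof (frullani_primitive_bounds a b x Ha Hab Hx) as H.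
assert (HL : 0 <= ln b - ln a) by (pose proof (ln_le a b Ha Hab); lra).
assert (He : exp (- (a * x)) <= / (a * x)).
{ rewrite exp_Ropp; apply Rinv_le_contravar; [nra|].
  pose proof (exp_ineq1_le (a * x)); lra. }
pose proof (exp_pos (- (b * x))).
replace ((ln b - ln a) / a / x) with (/ (a * x) * (ln b - ln a)) by (field; lra).
apply Rabs_le; nra.
Qed.

Lemma is_RInt_gen_frullani (a b : R) :
  0 < a -> a <= b ->
  is_RInt_gen (fun t => (exp (- (a * t)) - exp (- (b * t))) / t)
    (at_right 0) (Rbar_locally p_infty) (ln b - ln a).
Proof.
intros Ha Hab.
replace (ln b - ln a) with (0 - (ln a - ln b)) by ring.
apply is_RInt_gen_pos_primitive with (frullani_primitive a b).
- intros x Hx; apply is_derive_frullani_primitive; lra.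
- intros x Hx.
  apply (ex_derive_continuous (fun t => (exp (- (a * t)) - exp (- (b * t))) / t)).
  auto_derive; lra.
- now apply filterlim_frullani_primitive_0.
- now apply filterlim_frullani_primitive_p_infty.
Qed.

Lemma ln_1p_pos (t : R) : 0 < t -> 0 < ln (1 + t).
Proof. intros Ht; rewrite <- ln_1; apply ln_increasing; lra. Qed.

(** Frullani's formula after the substitution [x = ln (1 + t)]. *)
Lemma is_RInt_gen_frullani_ln (a b : R) :
  0 < a -> a <= b ->
  is_RInt_gen
    (fun t => (exp (- (a * ln (1 + t))) - exp (- (b * ln (1 + t)))) /
              ((1 + t) * ln (1 + t)))
    (at_right 0) (Rbar_locally p_infty) (ln b - ln a).
Proof.
intros Ha Hab.
replace (ln b - ln a) with (0 - (ln a - ln b)) by ring.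
apply is_RInt_gen_pos_primitive with (fun t => frullani_primitive a b (ln (1 + t))).
- intros t Ht; pose proof (ln_1p_pos t Ht) as Hu.
  replace ((exp (- (a * ln (1 + t))) - exp (- (b * ln (1 + t)))) / ((1 + t) * ln (1 + t)))
    with (/ (1 + t) * ((exp (- (a * ln (1 + t))) - exp (- (b * ln (1 + t)))) / ln (1 + t)))
    by (field; lra).
  apply (is_derive_comp (frullani_primitive a b) (fun t => ln (1 + t))).
  + apply is_derive_frullani_primitive; lra.
  + auto_derive; [lra|field; lra].
- intros t Ht; pose proof (ln_1p_pos t Ht) as Hu.
  apply (ex_derive_continuous (fun t =>
    (exp (- (a * ln (1 + t))) - exp (- (b * ln (1 + t)))) / ((1 + t) * ln (1 + t)))).
  auto_derive; repeat split; try lra; nra.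
- apply filterlim_comp with (at_right 0); [|now apply filterlim_frullani_primitive_0].
  intros P [eps HP]; exists eps; intros t Ht Ht0.
  pose proof (ln_1p_pos t Ht0) as Hu; apply HP; [|exact Hu].
  change (Rabs (t - 0) < eps) in Ht; change (Rabs (ln (1 + t) - 0) < eps).
  rewrite Rminus_0_r, Rabs_pos_eq in * by lra.
  apply Rle_lt_trans with t; [|exact Ht].
  rewrite <- (ln_exp t) at 2; apply ln_le; [lra|apply exp_ineq1_le].
- apply filterlim_comp with (Rbar_locally p_infty);
    [|now apply filterlim_frullani_primitive_p_infty].
  intros P HP; destruct (is_lim_ln_p P HP) as [M HM].
  exists M; intros t Ht; apply HM; lra.
Qed.

(** * The recurrence and the size of the integral *)

Lemma exp_opp_INR_ln (k : nat) (p : R) : 0 < p -> exp (- (INR k * ln p)) = / p ^ k.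
Proof. intros Hp; rewrite exp_Ropp, <- Rpower_pow by exact Hp; reflexivity. Qed.

Lemma catalan_integrand_S (n : nat) (t : R) :
  0 < t ->
  catalan_integrand (S n) t =
  catalan_integrand n t -
    (exp (- ((INR n + 1 / 2) * ln (1 + t))) - exp (- ((INR n + 2) * ln (1 + t)))) /
    ((1 + t) * ln (1 + t)).
Proof.
intros Ht; pose proof (ln_1p_pos t Ht) as Hu; unfold catalan_integrand.
replace (- ((INR n + 1 / 2) * ln (1 + t)))
  with (3 / 2 * ln (1 + t) + - (INR (n + 2) * ln (1 + t)))
  by (rewrite plus_INR; simpl; field).
replace (INR n + 2) with (INR (n + 2)) by (rewrite plus_INR; simpl; ring).
rewrite exp_plus, exp_opp_INR_ln by lra.
change (exp (3 / 2 * ln (1 + t))) with (Rpower (1 + t) (3 / 2)).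
replace (S n + 2)%nat with (S (n + 2)) by lia.
rewrite <- tech_pow_Rmult.
field; repeat split; try lra; apply pow_nonzero; lra.
Qed.

(** The integrand with [exp (- t)] replaced by [exp (- (n + 2) t)], which is close to the
    factor [1 / (1 + t) ^ (n + 2)] on the scale [t ~ 1 / n]. *)
Definition remainder (n : nat) (t : R) : R :=
  catalan_integrand n t + 3 / 2 * ((exp (- (1 * t)) - exp (- (INR (n + 2) * t))) / t).

(** An upper bound for [remainder n]: the first term comes from
    [((1 + t) ^ (3/2) - 1) / ln (1 + t) - 3/2], the second one from
    [1 / (1 + t) ^ (n + 2) - exp (- (n + 2) t)]. *)
Definition remainder_bound (n : nat) (t : R) : R :=
  9 / 4 / (1 + t) ^ n + 3 / 2 * (INR (n + 2) * t / (1 + t) ^ (n + 3)).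

Lemma remainder_bounds (n : nat) (t : R) :
  0 < t -> 0 <= remainder n t <= remainder_bound n t.
Proof.
intros Ht; pose proof (ln_1p_pos t Ht) as Hu.
unfold remainder, remainder_bound, catalan_integrand, Rpower.
set (u := ln (1 + t)) in *; set (q := exp (3 / 2 * u)).
set (M := INR (n + 2)); set (P := (1 + t) ^ (n + 2)).
assert (HM : 0 <= M) by apply pos_INR.
assert (HP : 0 < P) by (apply pow_lt; lra).
assert (HPM : / P = exp (- (M * u))) by (symmetry; apply exp_opp_INR_ln; lra).
assert (Hut : u <= t).
{ unfold u; rewrite <- (ln_exp t) at 2; apply ln_le; [lra|apply exp_ineq1_le]. }
assert (Heu : exp u = 1 + t) by (apply exp_ln; lra).
assert (Htu : t - u <= t ^ 2 / (1 + t)).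
{ assert (H : 1 - u <= / (1 + t)).
  { rewrite <- Heu, <- exp_Ropp; pose proof (exp_ineq1_le (- u)); lra. }
  replace (t ^ 2 / (1 + t)) with (t - 1 + / (1 + t)) by (field; lra); lra. }
assert (Hq1 : 1 + 3 / 2 * u <= q) by apply exp_ineq1_le.
assert (Hq2 : q - 1 <= 3 / 2 * u * q).
{ assert (H : 1 - 3 / 2 * u <= / q).
  { unfold q; rewrite <- exp_Ropp; pose proof (exp_ineq1_le (- (3 / 2 * u))); lra. }
  apply (Rmult_le_compat_r q) in H; [|lra]; rewrite Rinv_l in H by lra; lra. }
assert (Hq3 : q <= (1 + t) ^ 2).
{ replace ((1 + t) ^ 2) with (exp (u + u)) by (rewrite exp_plus, Heu; ring).
  left; apply exp_increasing; lra. }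
(* With [x = 3 u / 2]: [exp x - 1 - x <= x (exp x - 1) <= x ^ 2 exp x]. *)
assert (Hf : 0 <= (q - 1) / u - 3 / 2 <= 9 / 4 * t * (1 + t) ^ 2).
{ assert (Huq : u * q <= t * (1 + t) ^ 2) by (apply Rmult_le_compat; lra).
  split.
  - apply Rmult_le_reg_r with u; [exact Hu|].
    replace (((q - 1) / u - 3 / 2) * u) with (q - 1 - 3 / 2 * u) by (field; lra); lra.
  - apply Rmult_le_reg_r with u; [exact Hu|].
    replace (((q - 1) / u - 3 / 2) * u) with (q - 1 - 3 / 2 * u) by (field; lra).
    nra. }
assert (He : 0 <= / P - exp (- (M * t)) <= M * t ^ 2 / (1 + t) / P).
{ replace (exp (- (M * t))) with (/ P * exp (- (M * (t - u))))
    by (rewrite HPM, <- exp_plus; f_equal; ring).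
  assert (HiP : 0 < / P) by (apply Rinv_0_lt_compat; lra).
  assert (H1 : 1 - M * (t - u) <= exp (- (M * (t - u))))
    by (pose proof (exp_ineq1_le (- (M * (t - u)))); lra).
  assert (H2 : exp (- (M * (t - u))) <= 1).
  { rewrite <- exp_0; apply Rnot_lt_le; intros H; apply exp_lt_inv in H; nra. }
  assert (H3 : M * (t - u) <= M * t ^ 2 / (1 + t)).
  { unfold Rdiv; rewrite Rmult_assoc; apply Rmult_le_compat_l; assumption. }
  unfold Rdiv at 1; split; nra. }
replace (n + 3)%nat with (S (n + 2)) by lia.
rewrite <- tech_pow_Rmult; fold P.
assert (HPn : P = (1 + t) ^ n * (1 + t) ^ 2) by apply pow_add.
assert (Hn : 0 < (1 + t) ^ n) by (apply pow_lt; lra).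
replace (((q - 1) / (P * u) - 3 / 2 * exp (- t)) / t
  + 3 / 2 * ((exp (- (1 * t)) - exp (- (M * t))) / t))
  with (((q - 1) / u - 3 / 2) * (/ P * / t) + 3 / 2 * ((/ P - exp (- (M * t))) * / t))
  by (rewrite Rmult_1_l; field; lra).
replace (9 / 4 / (1 + t) ^ n) with (9 / 4 * t * (1 + t) ^ 2 * (/ P * / t))
  by (rewrite HPn; field; lra).
replace (M * t / ((1 + t) * P)) with (M * t ^ 2 / (1 + t) / P * / t) by (field; lra).
assert (Hit : 0 < / t) by (apply Rinv_0_lt_compat; lra).
assert (HPt : 0 < / P * / t)
  by (apply Rmult_lt_0_compat; [apply Rinv_0_lt_compat|]; lra).
split.
- apply Rplus_le_le_0_compat; [|apply Rmult_le_pos; [lra|]]; apply Rmult_le_pos; lra.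
- apply Rplus_le_compat; [|apply Rmult_le_compat_l; [lra|]]; apply Rmult_le_compat_r; lra.
Qed.

(** A primitive of [remainder_bound (m + 2)] that vanishes at infinity. *)
Definition remainder_bound_primitive (m : nat) (t : R) : R :=
  - (9 / 4 / INR (S m)) * / (1 + t) ^ S m
  + 3 / 2 * (/ (1 + t) ^ (m + 4) - INR (m + 4) / INR (m + 3) * / (1 + t) ^ (m + 3)).

Lemma is_derive_remainder_bound_primitive (m : nat) (t : R) :
  0 <= t -> is_derive (remainder_bound_primitive m) t (remainder_bound (m + 2) t).
Proof.
intros Ht; unfold remainder_bound_primitive, remainder_bound.
assert (Hp : forall k, (1 + t) ^ k <> 0) by (intros; apply pow_nonzero; lra).
assert (Hm := pos_INR m).
replace (m + 2 + 2)%nat with (S (S (S (S m)))) by lia.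
replace (m + 2 + 3)%nat with (S (S (S (S (S m))))) by lia.
replace (m + 2)%nat with (S (S m)) by lia.
replace (m + 4)%nat with (S (S (S (S m)))) by lia.
replace (m + 3)%nat with (S (S (S m))) by lia.
auto_derive.
- repeat split; repeat apply Rmult_integral_contrapositive_currified; try apply Hp; lra.
- rewrite !S_INR; simpl pow.
  change (match m with 0%nat => 1 | S _ => INR m + 1 end) with (INR (S m)).
  rewrite !S_INR; pose proof (Hp m); field.
  repeat split; lra.
Qed.

Lemma Rinv_pow_1p_le (k : nat) (t : R) :
  (0 < k)%nat -> 0 < t -> 0 <= / (1 + t) ^ k <= / t.
Proof.
intros Hk Ht; split.
- left; apply Rinv_0_lt_compat, pow_lt; lra.
- apply Rinv_le_contravar; [exact Ht|].
  apply Rle_trans with ((1 + t) ^ 1); [lra|apply Rle_pow; [lra|lia]].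
Qed.

Lemma is_RInt_gen_remainder (m : nat) :
  exists J : R, is_RInt_gen (remainder (m + 2)) (at_right 0) (Rbar_locally p_infty) J /\
    0 <= J <= 4 / INR (S m).
Proof.
assert (Hm := pos_INR m).
destruct (is_RInt_gen_pos_dominated (remainder (m + 2)) (remainder_bound (m + 2))
  (remainder_bound_primitive m) (remainder_bound_primitive m 0) 0)
  as [J [HJ HJb]].
- intros t Ht; pose proof (ln_1p_pos t Ht) as Hu.
  apply (ex_derive_continuous (remainder (m + 2))).
  unfold remainder, catalan_integrand, Rpower.
  assert (Hp : (1 + t) ^ (m + 2 + 2) <> 0) by (apply pow_nonzero; lra).
  auto_derive; repeat split; try lra.
  apply Rmult_integral_contrapositive_currified; lra.
- intros t Ht; apply (ex_derive_continuous (remainder_bound (m + 2))).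
  unfold remainder_bound.
  auto_derive; repeat split; apply pow_nonzero; lra.
- intros t Ht; now apply remainder_bounds.
- intros t Ht; apply is_derive_remainder_bound_primitive; lra.
- eapply filterlim_filter_le_1; [apply filter_le_within|].
  apply (ex_derive_continuous (remainder_bound_primitive m)).
  eexists; apply is_derive_remainder_bound_primitive; lra.
- set (K1 := 9 / 4 / INR (S m)); set (K2 := INR (m + 4) / INR (m + 3)).
  assert (HK1 : 0 <= K1).
  { unfold K1; rewrite S_INR; apply Rdiv_le_0_compat; lra. }
  assert (HK2 : 0 <= K2).
  { unfold K2; rewrite !plus_INR; simpl; apply Rdiv_le_0_compat; lra. }
  apply filterlim_p_infty_le with (K1 + 3 / 2 + 3 / 2 * K2); intros t Ht.
  unfold remainder_bound_primitive; fold K1 K2.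
  pose proof (Rinv_pow_1p_le (S m) t ltac:(lia) Ht).
  pose proof (Rinv_pow_1p_le (m + 4) t ltac:(lia) Ht).
  pose proof (Rinv_pow_1p_le (m + 3) t ltac:(lia) Ht).
  unfold Rdiv at 2; apply Rabs_le; nra.
- exists J; split; [exact HJ|]; split; [apply HJb|].
  apply Rle_trans with (1 := proj2 HJb).
  unfold remainder_bound_primitive; rewrite !Rplus_0_r, !pow1, !plus_INR, S_INR; simpl.
  apply Rminus_le_0.
  match goal with |- 0 <= ?e => replace e with
    ((INR m / 4 + 15 / 4) / ((INR m + 1) * (INR m + 3))) by (field; lra) end.
  apply Rdiv_le_0_compat; nra.
Qed.

(** * Wallis' integrals and the central binomial coefficient *)

(** The integral of [sin ^ n] over a quarter period. *)
Definition wallis_integral (n : nat) : R := RInt (fun x => sin x ^ n) 0 (PI / 2).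

Lemma continuous_sin_pow (n : nat) (x : R) : continuous (fun x => sin x ^ n) x.
Proof. apply (ex_derive_continuous (fun x => sin x ^ n)); auto_derive; exact I. Qed.

Lemma ex_RInt_sin_pow (n : nat) (a b : R) : ex_RInt (fun x => sin x ^ n) a b.
Proof.
apply (ex_RInt_continuous (fun x => sin x ^ n)); intros; apply continuous_sin_pow.
Qed.

(** Integration by parts: [- cos x * sin x ^ (n + 1)] vanishes at 0 and at [PI / 2], and
    its derivative is [(n + 2) sin x ^ (n + 2) - (n + 1) sin x ^ n]. *)
Lemma wallis_integral_SS (n : nat) :
  (INR n + 2) * wallis_integral (n + 2) = (INR n + 1) * wallis_integral n.
Proof.
set (F := fun x => - cos x * sin x ^ S n).
set (f := fun x => minus (scal (INR n + 2) (sin x ^ (n + 2))) (scal (INR n + 1) (sin x ^ n))).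
assert (H1 : is_RInt f 0 (PI / 2)
  (minus (scal (INR n + 2) (wallis_integral (n + 2)))
         (scal (INR n + 1) (wallis_integral n)))).
{ apply (is_RInt_minus (fun x => scal (INR n + 2) (sin x ^ (n + 2)))
    (fun x => scal (INR n + 1) (sin x ^ n))).
  - apply (is_RInt_scal (fun x => sin x ^ (n + 2))).
    apply (RInt_correct (fun x => sin x ^ (n + 2))), ex_RInt_sin_pow.
  - apply (is_RInt_scal (fun x => sin x ^ n)).
    apply (RInt_correct (fun x => sin x ^ n)), ex_RInt_sin_pow. }
assert (H2 : is_RInt f 0 (PI / 2) (minus (F (PI / 2)) (F 0))).
{ apply (is_RInt_derive F f); intros x _.
  - unfold F, f; auto_derive; [exact I|].
    change (Init.Nat.pred (S n)) with n.
    unfold minus, plus, opp, scal; simpl; unfold mult; simpl.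
    replace (sin x ^ (n + 2)) with (sin x ^ n * Rsqr (sin x))
      by (rewrite pow_add; unfold Rsqr; simpl; ring).
    replace (match n with 0%nat => 1 | S _ => INR n + 1 end) with (INR n + 1)
      by (destruct n; simpl; ring).
    unfold Rsqr.
    transitivity (sin x * sin x * sin x ^ n - Rsqr (cos x) * ((INR n + 1) * sin x ^ n));
      [unfold Rsqr; ring|rewrite cos2; unfold Rsqr; ring].
  - apply (ex_derive_continuous f); unfold f, minus, plus, opp, scal; simpl;
      unfold mult; simpl; auto_derive; exact I. }
pose proof (is_RInt_unique _ _ _ _ H1) as E1; rewrite (is_RInt_unique _ _ _ _ H2) in E1.
unfold F, minus, plus, opp, scal in E1; simpl in E1; unfold mult in E1; simpl in E1.
rewrite cos_PI2, sin_0 in E1; lra.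
Qed.

Lemma wallis_integral_S_le (n : nat) : wallis_integral (S n) <= wallis_integral n.
Proof.
pose proof PI_RGT_0.
apply RInt_le; [lra|apply (ex_RInt_sin_pow (S n))|apply ex_RInt_sin_pow|].
intros x Hx; rewrite <- tech_pow_Rmult.
assert (0 < sin x) by (apply sin_gt_0; lra).
pose proof (SIN_bound x); pose proof (pow_lt (sin x) n); nra.
Qed.

(** The central binomial coefficient divided by [4 ^ n]. *)
Definition central_ratio (n : nat) : R := Binomial.C (2 * n) n / 4 ^ n.

Lemma central_ratio_pos (n : nat) : 0 < central_ratio n.
Proof.
unfold central_ratio, Binomial.C.
repeat (apply Rdiv_lt_0_compat || apply Rmult_lt_0_compat); try apply INR_fact_lt_0.
apply pow_lt; lra.
Qed.

Lemma central_ratio_S (n : nat) :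
  central_ratio (S n) = central_ratio n * ((2 * INR n + 1) / (2 * INR n + 2)).
Proof.
unfold central_ratio, Binomial.C.
replace (2 * S n - S n)%nat with (S n) by lia.
replace (2 * n - n)%nat with n by lia.
replace (2 * S n)%nat with (S (S (2 * n))) by lia.
rewrite !fact_simpl, !mult_INR, !S_INR, mult_INR, <- tech_pow_Rmult; change (INR 2) with 2.
pose proof (pos_INR n); pose proof (INR_fact_neq_0 n).
assert (4 ^ n <> 0) by (apply pow_nonzero; lra).
field; repeat split; lra.
Qed.

Lemma wallis_integral_even (n : nat) :
  wallis_integral (2 * n) = PI / 2 * central_ratio n.
Proof.
induction n as [|n IH].
- unfold wallis_integral, central_ratio, Binomial.C; simpl.
  rewrite RInt_const; unfold scal; simpl; unfold mult; simpl; field.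
- replace (2 * S n)%nat with (2 * n + 2)%nat by lia.
  pose proof (wallis_integral_SS (2 * n)) as H.
  rewrite IH, mult_INR in H; change (INR 2) with 2 in H.
  pose proof (pos_INR n).
  rewrite central_ratio_S.
  apply Rmult_eq_reg_l with (2 * INR n + 2); [|lra].
  rewrite H; field; lra.
Qed.

Lemma wallis_integral_odd (n : nat) :
  wallis_integral (2 * n + 1) = / ((2 * INR n + 1) * central_ratio n).
Proof.
induction n as [|n IH].
- assert (H : is_RInt (fun x => sin x ^ 1) 0 (PI / 2) (minus (- cos (PI / 2)) (- cos 0))).
  { apply (is_RInt_derive (fun x => - cos x) (fun x => sin x ^ 1)); intros x _.
    - auto_derive; [exact I|ring].
    - apply continuous_sin_pow. }
  unfold wallis_integral; simpl (2 * 0 + 1)%nat; rewrite (is_RInt_unique _ _ _ _ H).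
  rewrite cos_PI2, cos_0; unfold minus, plus, opp, central_ratio, Binomial.C; simpl; field.
- replace (2 * S n + 1)%nat with (2 * n + 1 + 2)%nat by lia.
  pose proof (wallis_integral_SS (2 * n + 1)) as H.
  rewrite IH, plus_INR, mult_INR in H; change (INR 2) with 2 in H; change (INR 1) with 1 in H.
  pose proof (pos_INR n); pose proof (central_ratio_pos n).
  rewrite central_ratio_S, S_INR.
  apply Rmult_eq_reg_l with (2 * INR n + 1 + 2); [|lra].
  rewrite H; field; repeat split; lra.
Qed.

(** The monotonicity of Wallis' integrals at the indices [2 n], [2 n + 1], [2 n + 2]. *)
Lemma central_ratio_sqr_bounds (n : nat) :
  2 / (2 * INR n + 1) <= PI * central_ratio n ^ 2
    <= 4 * (INR n + 1) / (2 * INR n + 1) ^ 2.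
Proof.
pose proof (pos_INR n) as Hn; pose proof (central_ratio_pos n) as Hb.
pose proof PI_RGT_0 as Hpi.
pose proof (wallis_integral_S_le (2 * n)) as H1.
pose proof (wallis_integral_S_le (2 * n + 1)) as H2.
replace (S (2 * n)) with (2 * n + 1)%nat in H1 by lia.
replace (S (2 * n + 1)) with (2 * S n)%nat in H2 by lia.
rewrite wallis_integral_even, wallis_integral_odd in H1, H2.
rewrite central_ratio_S in H2.
set (b := central_ratio n) in *; set (x := INR n) in *.
split.
- apply (Rmult_le_compat_l (2 * b)) in H1; [|lra].
  replace (2 * b * / ((2 * x + 1) * b)) with (2 / (2 * x + 1)) in H1 by (field; lra).
  lra.
- apply (Rmult_le_compat_l (2 * b * (2 * x + 2) / (2 * x + 1))) in H2.
  2: { left; apply Rdiv_lt_0_compat; [|lra]; nra. }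
  replace (2 * b * (2 * x + 2) / (2 * x + 1) *
    (PI / 2 * (b * ((2 * x + 1) / (2 * x + 2))))) with (PI * b ^ 2) in H2 by (field; lra).
  replace (2 * b * (2 * x + 2) / (2 * x + 1) * / ((2 * x + 1) * b))
    with (4 * (x + 1) / (2 * x + 1) ^ 2) in H2 by (field; lra).
  exact H2.
Qed.

(** * Asymptotics of the Catalan numbers *)

(** Equal to [Gamma (n + 1/2) / Gamma (n + 2)]; the integral is its logarithm. *)
Definition normalized_catalan (n : nat) : R := catalan n * sqrt PI / 4 ^ n.

Lemma normalized_catalan_central_ratio (n : nat) :
  normalized_catalan n = central_ratio n * sqrt PI / (INR n + 1).
Proof.
unfold normalized_catalan, catalan, central_ratio; pose proof (pos_INR n).
field; split; [apply pow_nonzero|]; lra.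
Qed.

Lemma normalized_catalan_pos (n : nat) : 0 < normalized_catalan n.
Proof.
rewrite normalized_catalan_central_ratio.
pose proof (pos_INR n); pose proof (central_ratio_pos n); pose proof (sqrt_lt_R0 _ PI_RGT_0).
apply Rdiv_lt_0_compat; nra.
Qed.

Lemma ln_normalized_catalan_S (n : nat) :
  ln (normalized_catalan (S n)) =
  ln (normalized_catalan n) - (ln (INR n + 2) - ln (INR n + 1 / 2)).
Proof.
pose proof (pos_INR n).
replace (normalized_catalan (S n))
  with (normalized_catalan n * ((INR n + 1 / 2) / (INR n + 2))).
2: { rewrite !normalized_catalan_central_ratio, central_ratio_S, S_INR; field; lra. }
rewrite ln_mult, ln_div; try lra.
- apply normalized_catalan_pos.
- apply Rdiv_lt_0_compat; lra.
Qed.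

(** The error term comes from [1 <= X <= 1 + 31 / (n + 1)], where
    [X = A n ^ 2 * (n + 2) ^ 3] and [A n] is the normalized Catalan number.
    The constant 31 makes the polynomial inequality behind the upper bound have
    nonnegative coefficients. *)
Lemma ln_normalized_catalan_asymptotic (n : nat) :
  0 <= 2 * ln (normalized_catalan n) + 3 * ln (INR (n + 2)) <= 31 / (INR n + 1).
Proof.
pose proof (pos_INR n) as Hn; pose proof (normalized_catalan_pos n) as HA.
rewrite plus_INR; change (INR 2) with 2.
set (X := normalized_catalan n ^ 2 * (INR n + 2) ^ 3).
assert (HX : X = PI * central_ratio n ^ 2 * ((INR n + 2) ^ 3 / (INR n + 1) ^ 2)).
{ unfold X; rewrite normalized_catalan_central_ratio.
  rewrite <- (pow2_sqrt PI) at 2 by (left; exact PI_RGT_0).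
  field; lra. }
replace (2 * ln (normalized_catalan n) + 3 * ln (INR n + 2)) with (ln X).
2: { unfold X.
     rewrite ln_mult, !ln_pow by (try apply pow_lt; lra); simpl; ring. }
pose proof (central_ratio_sqr_bounds n) as [Hl Hu].
set (x := INR n) in *; set (w := PI * central_ratio n ^ 2) in *.
assert (Hr : 0 <= (x + 2) ^ 3 / (x + 1) ^ 2).
{ apply Rdiv_le_0_compat; [left|]; apply pow_lt; lra. }
apply (Rmult_le_compat_r _ _ _ Hr) in Hl, Hu; rewrite <- HX in Hl, Hu.
assert (H1 : 1 <= X).
{ apply Rle_trans with (2 := Hl); apply Rminus_le_0.
  replace (2 / (2 * x + 1) * ((x + 2) ^ 3 / (x + 1) ^ 2) - 1)
    with ((7 * x ^ 2 + 20 * x + 15) / ((2 * x + 1) * (x + 1) ^ 2)) by (field; lra).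
  apply Rdiv_le_0_compat; nra. }
assert (H2 : X <= 1 + 31 / (x + 1)).
{ apply Rle_trans with (1 := Hu); apply Rminus_le_0.
  replace (1 + 31 / (x + 1) - 4 * (x + 1) / (2 * x + 1) ^ 2 * ((x + 2) ^ 3 / (x + 1) ^ 2))
    with ((108 * x ^ 2 + 81 * x) / ((2 * x + 1) ^ 2 * (x + 1))) by (field; lra).
  apply Rdiv_le_0_compat; nra. }
split.
- rewrite <- ln_1; apply ln_le; lra.
- rewrite <- (ln_exp (31 / (x + 1))); apply ln_le; [lra|].
  apply Rle_trans with (1 := H2), exp_ineq1_le.
Qed.

(** * Evaluation of the integral *)

(** The difference between the integral and [ln (normalized_catalan n)] does not depend
    on [n]. *)
Lemma is_RInt_gen_catalan_integrand_S (n : nat) (c : R) :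
  is_RInt_gen (catalan_integrand n) (at_right 0) (Rbar_locally p_infty)
    (ln (normalized_catalan n) + c) <->
  is_RInt_gen (catalan_integrand (S n)) (at_right 0) (Rbar_locally p_infty)
    (ln (normalized_catalan (S n)) + c).
Proof.
pose proof (pos_INR n) as Hn.
assert (HF := is_RInt_gen_frullani_ln (INR n + 1 / 2) (INR n + 2) ltac:(lra) ltac:(lra)).
split; intros H.
- apply is_RInt_gen_pos_ext with (1 := fun t Ht => eq_sym (catalan_integrand_S n t Ht)).
  rewrite ln_normalized_catalan_S.
  match goal with |- is_RInt_gen _ _ _ ?l => replace l with
    (minus (ln (normalized_catalan n) + c) (ln (INR n + 2) - ln (INR n + 1 / 2)))
    by (unfold minus, plus, opp; simpl; ring) end.
  exact (is_RInt_gen_minus _ _ _ _ H HF).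
- match goal with |- is_RInt_gen _ _ _ ?l => replace l with
    (plus (ln (normalized_catalan (S n)) + c) (ln (INR n + 2) - ln (INR n + 1 / 2)))
    by (rewrite ln_normalized_catalan_S; unfold plus; simpl; ring) end.
  eapply is_RInt_gen_pos_ext; [|exact (is_RInt_gen_plus _ _ _ _ H HF)].
  intros t Ht; cbv beta; rewrite catalan_integrand_S by exact Ht.
  unfold plus; simpl; ring.
Qed.

Lemma is_RInt_gen_catalan_integrand_bounds (m : nat) :
  exists l : R, is_RInt_gen (catalan_integrand (m + 2)) (at_right 0) (Rbar_locally p_infty) l /\
    0 <= l + 3 / 2 * ln (INR (m + 2 + 2)) <= 4 / INR (S m).
Proof.
destruct (is_RInt_gen_remainder m) as [J [HJ HJb]].
set (M := INR (m + 2 + 2)).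
assert (HM : 1 <= M).
{ unfold M; rewrite !plus_INR; pose proof (pos_INR m); simpl; lra. }
exists (J - 3 / 2 * ln M); split; [|lra].
assert (HF := is_RInt_gen_frullani 1 M ltac:(lra) HM).
rewrite ln_1, Rminus_0_r in HF.
apply (is_RInt_gen_scal _ (3 / 2)) in HF.
eapply is_RInt_gen_pos_ext; [|exact (is_RInt_gen_minus _ _ _ _ HJ HF)].
intros t Ht; unfold remainder, minus, plus, opp, scal; simpl; unfold mult; simpl.
fold M; ring.
Qed.

Lemma Rabs_le_all_div_S_eq_0 (x K : R) : (forall m, Rabs x <= K / INR (S m)) -> x = 0.
Proof.
intros H; destruct (Req_dec x 0) as [|Hx]; [assumption|exfalso].
apply Rabs_pos_lt in Hx.
destruct (nfloor_ex (Rabs (K / Rabs x)) (Rabs_pos _)) as [m [_ Hm]].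
specialize (H m); rewrite S_INR in H.
assert (Hp := pos_INR m).
apply (Rmult_le_compat_r (INR m + 1)) in H; [|lra].
replace (K / (INR m + 1) * (INR m + 1)) with (K / Rabs x * Rabs x) in H by (field; lra).
pose proof (Rle_abs (K / Rabs x)); nra.
Qed.

Lemma is_RInt_gen_catalan_integrand (n : nat) :
  is_RInt_gen (catalan_integrand n) (at_right 0) (Rbar_locally p_infty)
    (ln (normalized_catalan n)).
Proof.
destruct (is_RInt_gen_catalan_integrand_bounds 0) as [l [Hl _]].
set (c := l - ln (normalized_catalan 2)).
assert (Hc : forall k, is_RInt_gen (catalan_integrand k) (at_right 0) (Rbar_locally p_infty)
  (ln (normalized_catalan k) + c)).
{ induction k as [|k IH].
  (* The convergence is known at the index 2, two steps above. *)
  - apply is_RInt_gen_catalan_integrand_S, is_RInt_gen_catalan_integrand_S.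
    unfold c; replace (ln (normalized_catalan 2) + (l - ln (normalized_catalan 2)))
      with l by ring; exact Hl.
  - exact (proj1 (is_RInt_gen_catalan_integrand_S k c) IH). }
replace (ln (normalized_catalan n)) with (ln (normalized_catalan n) + c); [apply Hc|].
enough (c = 0) by lra.
apply Rabs_le_all_div_S_eq_0 with 31; intros m.
destruct (is_RInt_gen_catalan_integrand_bounds m) as [lm [Hlm Hb]].
assert (E : ln (normalized_catalan (m + 2)) + c = lm).
{ rewrite <- (is_RInt_gen_unique _ _ Hlm).
  symmetry; exact (is_RInt_gen_unique _ _ (Hc (m + 2)%nat)). }
(* [2 c] is the difference of two quantities in [0, 8 / (m + 1)] and [0, 31 / (m + 1)]. *)
pose proof (ln_normalized_catalan_asymptotic (m + 2)) as Ha.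
assert (Hm := pos_INR m).
assert (H31 : 31 / (INR (m + 2) + 1) <= 31 / INR (S m)).
{ rewrite plus_INR, (S_INR m); change (INR 2) with 2; apply Rmult_le_compat_l; [lra|].
  apply Rinv_le_contravar; lra. }
assert (0 < / INR (S m)) by (rewrite S_INR; apply Rinv_0_lt_compat; lra).
unfold Rdiv in *; apply Rabs_le; lra.
Qed.

Theorem theorem1 (n : nat) (hn : (0 < n)%nat) :
  ex_RInt_gen (catalan_integrand n) (at_right 0) (Rbar_locally p_infty) /\
  catalan n =
    2 ^ (2 * n) / sqrt PI *
    exp (RInt_gen (catalan_integrand n) (at_right 0) (Rbar_locally p_infty)).
Proof.
pose proof (is_RInt_gen_catalan_integrand n) as H.
split; [eexists; exact H|].
rewrite (is_RInt_gen_unique _ _ H), exp_ln by apply normalized_catalan_pos.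
unfold normalized_catalan; rewrite pow_mult; replace (2 ^ 2) with 4 by ring.
pose proof (sqrt_lt_R0 _ PI_RGT_0).
field; split; [apply pow_nonzero|]; lra.
Qed.
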